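(* Let $p\in\mathbb Z$ and $q\in\mathbb N^*$ be relatively prime, $\gamma=2\pi p/q$ and $\omega\in\mathbb R$. Let $Q_\omega$ be the polynomial, independent of $(\theta_1,\theta_2)$, such that for all $(\theta_1,\theta_2)\in\mathbb R^2$ and all $\lambda$ $$\det(M_K(\theta_1,\theta_2,\omega)-\lambda I_{3q})=Q_\omega(\lambda)+2\,p^\triangle\big(q(\theta_1+p\pi),q(\theta_2+p\pi)\big)\Big(\lambda+2\cos\big(3\omega-\tfrac{\gamma}{8}\big)\Big)^q .$$ Then a flat band of $M_K(\cdot,\cdot,\omega)$ exists if and only if $$Q_\omega\Big(-2\cos\big(3\omega-\tfrac{\gamma}{8}\big)\Big)=0 .$$
   Context: Let $p\in\mathbb Z$, $q\in\mathbb N^*$ be relatively prime and $\gamma=2\pi p/q$. The $q\times q$ matrices $J_{p,q}$ and $K_q$ are $J_{p,q}=\mathrm{diag}(e^{i(j-1)\gamma})_{j=1,\dots,q}$ and $(K_q)_{jk}=1$ if $k\equiv j+1 \pmod q$, $0$ otherwise. The kagome (Hou) matrix is the $3q\times3q$ Hermitian matrix $$M_K(\theta_1,\theta_2,\omega)=\begin{pmatrix} 0 & A & B \\ A^* & 0 & C \\ B^* & C^* & 0 \end{pmatrix}$$ with $$A=e^{i(\omega+\gamma/8)}\big(e^{-i\theta_1}J_{p,q}^*+e^{-i\gamma/2}e^{-i(\theta_1-\theta_2)}J_{p,q}^*K_q\big),$$ $$B=e^{-i(\omega+\gamma/8)}\big(e^{-i\theta_1}J_{p,q}^*+e^{-i\theta_2}K_q^*\big),$$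 $$C=e^{i(\omega+\gamma/8)}\big(e^{-i\gamma/2}e^{i(\theta_1-\theta_2)}J_{p,q}K_q^*+e^{-i\theta_2}K_q^*\big).$$ Also $p^\triangle(x,\xi)=\cos x+\cos\xi+\cos(x-\xi)$. A polynomial $Q_\omega$ with the displayed property exists and is unique. Order the eigenvalues of $M_K(\theta_1,\theta_2,\omega)$, counted with multiplicity, as $\lambda_1(\theta)\le\dots\le\lambda_{3q}(\theta)$. The $k$-th band is the set $\{\lambda_k(\theta_1,\theta_2):(\theta_1,\theta_2)\in\mathbb R^2\}$. The band is called flat if $\lambda_k(\theta_1,\theta_2)$ is independent of $(\theta_1,\theta_2)$. *)

(* Defs.v *)
From mathcomp Require Import all_boot all_order all_algebra.
From mathcomp Require Import all_classical all_reals all_analysis.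
From mathcomp Require Import complex.

Set Implicit Arguments.
Unset Strict Implicit.
Unset Printing Implicit Defensive.

Import Order.TTheory GRing.Theory Num.Theory.
Local Open Scope ring_scope.
Local Open Scope sesquilinear_scope.
Local Open Scope complex_scope.

Definition expi (R : realType) (t : R) : R[i] := cos t +i* sin t.

Definition gammapq (R : realType) (p : int) (q : nat) : R :=
  2 * pi * p%:~R / q%:R.

Definition ptriangle (R : realType) (x xi : R) : R :=
  cos x + cos xi + cos (x - xi).

(* Rows and columns are numbered from 0: the mathematical index j in 1..q is
   the ordinal j - 1. *)
Definition Jmx (R : realType) (p : int) (q : nat) : 'M[R[i]]_q :=
  diag_mx (\row_(j < q) expi (j%:R * gammapq R p q)).

Definition Kmx (R : realType) (q : nat) : 'M[R[i]]_q :=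
  \matrix_(j < q, k < q) (k == j.+1 %[mod q])%:R.

Section Kagome.
Variables (R : realType) (p : int) (q : nat) (theta1 theta2 omega : R).
Let g : R := gammapq R p q.
Let J := Jmx R p q.
Let K := Kmx R q.

Definition kagomeA : 'M[R[i]]_q :=
  expi (omega + g / 8) *:
    (expi (- theta1) *: J ^t*
     + (expi (- g / 2) * expi (- (theta1 - theta2))) *: (J ^t* *m K)).

Definition kagomeB : 'M[R[i]]_q :=
  expi (- (omega + g / 8)) *:
    (expi (- theta1) *: J ^t* + expi (- theta2) *: K ^t*).

Definition kagomeC : 'M[R[i]]_q :=
  expi (omega + g / 8) *:
    ((expi (- g / 2) * expi (theta1 - theta2)) *: (J *m K ^t*)
     + expi (- theta2) *: K ^t*).

Definition kagome_mx : 'M[R[i]]_(q + (q + q)) :=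
  block_mx 0 (row_mx kagomeA kagomeB)
           (col_mx (kagomeA ^t*) (kagomeB ^t*))
           (block_mx 0 kagomeC (kagomeC ^t*) 0).

End Kagome.

(* The roots of the characteristic polynomial with multiplicity, in
   nondecreasing order.  Taking real parts loses nothing for a Hermitian
   matrix; the result is not meaningful for matrices with non-real spectrum. *)
Definition ordered_eigenvalues (R : realType) (n : nat) (M : 'M[R[i]]_n) :
    seq R :=
  sort <=%R [seq complex.Re z
            | z <- sval (closed_field_poly_normal (char_poly M))].

(* The k-th band function, numbered from k = 0 to k = 3q - 1. *)
Definition band_fun (R : realType) (p : int) (q : nat) (omega : R) (k : nat)
    (theta1 theta2 : R) : R :=
  (ordered_eigenvalues (kagome_mx p q theta1 theta2 omega))`_k.

Definition flat_band (R : realType) (p : int) (q : nat) (omega : R)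
    (k : nat) : Prop :=
  forall theta1 theta2 theta1' theta2' : R,
    band_fun p q omega k theta1 theta2 = band_fun p q omega k theta1' theta2'.

(* Main.v *)
Require Import Defs.
From mathcomp Require Import all_boot all_order all_algebra.
From mathcomp Require Import all_classical all_reals all_analysis.
From mathcomp Require Import complex.
From mathcomp Require Import zify ring lra.

(** Write [t] for the value of the trigonometric factor p^triangle and [l0] for
    [- 2 cos (3 omega - gamma / 8)].  For real [x] the determinant is
    [Q.[x] + 2 t (x - l0) ^+ q], a pencil in which [theta1, theta2] enter only
    through [t]; as they vary, [t] fills exactly the interval [[-3/2, 3]]
    ([ptriangle_bounds], [ptriangle_surj]).

    If a band is constant with value [c], then [Q.[c] + 2 t (c - l0) ^+ q]
    vanishes for all these [t], which forces [c = l0] and [Q.[l0] = 0]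
    ([flat_band_root]).

    Conversely, if [Q.[l0] = 0] then [l0] is an eigenvalue for every [theta];
    the point is that its rank in the ordered list of eigenvalues can be chosen
    independently of [theta].  It suffices to find one [k] such that, for all
    [theta], at most [k] eigenvalues are below [l0] and at most [3 q - 1 - k]
    are above it ([nth_sort_eq]).  After the translation of [l0] to the origin
    the characteristic polynomials form a pencil [G + t *: 'X^q] of real-rooted
    polynomials in which a single coefficient moves, and Descartes' rule of
    signs ([descartes_pos], [descartes_neg]) bounds both numbers by sign changes
    of the coefficient sequence.  Since the sign changes of [p(X)] and [p(-X)]
    add up to at most the degree minus the order at the origin
    ([sign_changes_bound]), there is room for a common [k] ([pencil_index]):
    - if the moving coefficient never vanishes, the sign changes are constant;
    - if it vanishes for some [t] and [q] exceeds the order of [G] at the origin,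
      then at that [t] the rule of signs is an equality for the real-rooted
      polynomial.  A nonzero coefficient put in place of the zero cannot lower
      the number of sign changes, and the bound leaves no room to increase it,
      so the sign changes are constant again;
    - if all lower coefficients vanish, the moving coefficient is the first one:
      it changes either count by at most one, and the multiplicity of the
      eigenvalue is at least [q], which absorbs this when [q >= 2].

    The last argument fails for [q = 1], where the eigenvalue may be simple.
    There [Q] is computed from the parameters at which two of the three blocks
    of the matrix vanish ([det_kagome1]): the condition [Q.[l0] = 0] becomes
    [l0 ^+ 3 = 4 * l0], so [l0] is [0], [2] or [-2], and in each case the signs
    of the coefficients decide ([pencil_index1]). *)

Set Implicit Arguments.
Unset Strict Implicit.
Unset Printing Implicit Defensive.

Import Order.TTheory GRing.Theory Num.Theory.
Local Open Scope ring_scope.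
Local Open Scope sesquilinear_scope.
Local Open Scope complex_scope.

(** * Sign changes of a sequence of coefficients *)

Section SignChanges.
Variable R : realFieldType.
Implicit Types (a b c e x T : R) (s l rs : seq R) (p : {poly R}).

(** Zero entries are skipped; [a] is the last nonzero entry met so far, and
    [0] stands for none, since [0 * b] is never negative. *)
Fixpoint sign_changes a s : nat :=
  if s is b :: s' then
    if b == 0 then sign_changes a s' else ((a * b < 0)%R + sign_changes b s')%N
  else 0%N.

(** The coefficients of [p (- X)] from those of [p]. *)
Fixpoint alternate s : seq R :=
  if s is b :: s' then b :: map -%R (alternate s') else [::].

(** The coefficients of [('X - c%:P) * p] when [x = 0] and [s] lists those of
    [p]; in general [x] is the coefficient preceding [s]. *)
Fixpoint mul_linear c x s : seq R :=
  if s is b :: s' then (x - c * b) :: mul_linear c b s' else [:: x].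

Lemma sign_changesN a s : sign_changes a (map -%R s) = sign_changes (- a) s.
Proof.
elim: s a => [|d s IH] a //=.
by rewrite oppr_eq0 mulrN mulNr !IH opprK.
Qed.

Lemma mulr_lt0_gt0 a b : a != 0 -> b != 0 -> (a * b < 0) = (0 < a) (+) (0 < b).
Proof.
move=> a0 b0; case: (ltgtP a 0) a0 => [ha|ha|->] // _.
  by rewrite nmulr_rlt0.
by rewrite pmulr_rlt0 // ltNge le_eqVlt eq_sym (negbTE b0).
Qed.

Lemma mulr_gt0_gt0 a b : a != 0 -> b != 0 -> (0 < a * b) = ((0 < a) == (0 < b)).
Proof.
move=> a0 b0; have ab0 : a * b != 0 by rewrite mulf_neq0.
rewrite lt0r ab0 leNgt mulr_lt0_gt0 //=.
by case: (0 < a); case: (0 < b).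
Qed.

(** Passing through [b] on the way from [a] to the first nonzero entry of [s]
    can add sign changes but not remove any. *)
Lemma sign_changes_ge a b s : b != 0 ->
  (sign_changes a s <= (a * b < 0)%R + sign_changes b s)%N.
Proof.
move=> b0; elim: s => [|d s IH] //=; case: (eqVneq d 0) => // d0.
suff : ((a * d < 0)%R <= (a * b < 0)%R + (b * d < 0)%R)%N.
  move: (nat_of_bool (a * d < 0)) (nat_of_bool (a * b < 0)).
  by move: (nat_of_bool (b * d < 0)) => *; lia.
have [->|a0] := eqVneq a 0; first by rewrite mul0r ltxx.
by rewrite !mulr_lt0_gt0 //; case: (0 < a); case: (0 < b); case: (0 < d).
Qed.

Lemma sign_changes_le0 a s : (sign_changes a s <= (sign_changes 0 s).+1)%N.
Proof. by elim: s => [|d s IH] //=; case: ifP => // _; rewrite mul0r ltxx; lia. Qed.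

Lemma sign_changes_insert a (s s' : seq R) (q : nat) : size s = size s' ->
  s`_q = 0 -> (forall i, i != q -> s`_i = s'`_i) ->
  (sign_changes a s <= sign_changes a s')%N.
Proof.
elim: s s' q a => [|b s IH] [|b' s'] [|q] a //= [ss] hq h.
  have -> : s = s'.
    apply: (@eq_from_nth _ 0) => // i _; exact: (h i.+1).
  rewrite hq eqxx; case: (eqVneq b' 0) => // b0; exact: sign_changes_ge.
have <- : b = b' := h 0%N isT.
have hs i : i != q -> s`_i = s'`_i by move=> iq; apply: (h i.+1).
by case: eqP => _; [exact: IH hs|rewrite leq_add2l; exact: IH hs].
Qed.

(** Only one comparison, of the entry [q] with the next nonzero entry, can be
    created. *)
Lemma sign_changes_first (s s' : seq R) (q : nat) : size s = size s' ->
  (forall i, (i <= q)%N -> s`_i = 0) ->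
  (forall i, i != q -> s`_i = s'`_i) ->
  (sign_changes 0 s' <= (sign_changes 0 s).+1)%N.
Proof.
elim: s s' q => [|b s IH] [|b' s'] q //= [ss] h0 h.
have -> : b = 0 := h0 0%N isT.
rewrite eqxx; case: q h0 h => [|q] h0 h.
  have <- : s = s'.
    apply: (@eq_from_nth _ 0) => // i _; exact: (h i.+1).
  by rewrite mul0r ltxx; case: eqP => _ //; exact: sign_changes_le0.
have <- : b = b' := h 0%N isT.
have -> : b = 0 := h0 0%N isT.
rewrite eqxx; apply: (IH _ q ss) => [i hi|i hi]; first exact: (h0 i.+1).
exact: (h i.+1).
Qed.

Lemma mulr_lt0_sg a b : (a * b < 0) = (Num.sg a * Num.sg b < 0).
Proof. by rewrite -sgrM -[RHS]sgr_lt0 sgr_id sgr_lt0. Qed.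

Lemma sign_changes_sg a a' s s' : size s = size s' ->
  Num.sg a = Num.sg a' -> (forall i, Num.sg s`_i = Num.sg s'`_i) ->
  sign_changes a s = sign_changes a' s'.
Proof.
elim: s s' a a' => [|b s IH] [|b' s'] a a' //= [ss] ha h.
have hb : Num.sg b = Num.sg b' := h 0%N.
have hs i : Num.sg s`_i = Num.sg s'`_i := h i.+1.
rewrite -sgr_eq0 hb sgr_eq0 (IH s' a a') // (IH s' b b') //.
by rewrite mulr_lt0_sg ha hb -mulr_lt0_sg.
Qed.

(** Two consecutive nonzero entries at odd distance contribute one change to
    exactly one of the two sequences, at even distance zero or two changes in
    all; in either case at most the distance.  The two inequalities
    follow the parity of the distance to the last nonzero entry [b]: its image
    in the alternating sequence, transported to the next position, is [- b] or
    [b]. *)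
Lemma sign_changes_alternate_ub b s : b != 0 ->
  (sign_changes b s + sign_changes (- b) (alternate s) <= size s)%N /\
  (sign_changes b s + sign_changes b (alternate s) <= (size s).+1)%N.
Proof.
elim: s b => [|d s IH] b b0 //=.
have Nb0 : - b != 0 by rewrite oppr_eq0.
case: (eqVneq d 0) => [_|d0].
  by rewrite !sign_changesN opprK; have [] := IH _ b0; lia.
rewrite sign_changesN.
have [h _] := IH _ d0.
have : ((b * d < 0)%R + (- b * d < 0)%R <= 1)%N.
  by rewrite mulNr oppr_lt0; case: (ltgtP (b * d) 0).
have : ((b * d < 0)%R <= 1)%N by case: (_ < _).
move: h (nat_of_bool (b * d < 0)) (nat_of_bool (- b * d < 0)) => h u v; lia.
Qed.

Lemma sign_changes_bound (m : nat) s : (forall i, (i < m)%N -> s`_i = 0) ->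
  last 0 s != 0 ->
  (sign_changes 0 s + sign_changes 0 (alternate s) + m < size s)%N.
Proof.
elim: s m => [|d s IH] m //=; first by rewrite eqxx.
case: m => [|m] hm hl; last first.
  have d0 : d = 0 := hm 0%N isT.
  rewrite d0 in hl *.
  rewrite eqxx sign_changesN oppr0.
  by rewrite addnS ltnS; exact: IH m (fun i hi => hm i.+1 hi) hl.
case: (eqVneq d 0) => [d0|d0].
  rewrite sign_changesN oppr0.
  rewrite d0 in hl *.
  by apply: leqW; exact: IH 0%N (fun i hi => ltac:(by [])) hl.
rewrite sign_changesN mul0r ltxx !add0n addn0 ltnS.
by have [] := sign_changes_alternate_ub s d0.
Qed.

Lemma size_alternate s : size (alternate s) = size s.
Proof. by elim: s => //= b s IH; rewrite size_map IH. Qed.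

Lemma nth_alternate s i : (alternate s)`_i = (-1) ^+ i * s`_i.
Proof.
elim: s i => [|b s IH] [|i] /=; rewrite ?nth_nil ?mulr0 ?expr0 ?mul1r //.
have [hi|hi] := ltnP i (size s); last first.
  by rewrite !nth_default ?mulr0 ?size_map ?size_alternate.
by rewrite (nth_map 0) ?size_alternate // IH exprS mulN1r mulNr.
Qed.

(** * Descartes' rule of signs *)

(** [T] is the last nonzero coefficient of [p] met so far, [e] that of the
    product [('X - c%:P) * p], and [x], equal to [T] up to a positive factor
    unless it vanishes, is the coefficient of [p] preceding [l].  When [p]
    changes sign from [x] to [a], the product has there the coefficient
    [x - c * a], of the sign of [x]; so if [e] and [T] had opposite signs, the
    product changes sign as well, and otherwise the credit [0 < T * e] is spent.
    After a sign change of [p] the signs of [e] and [T] are opposite, and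
    credit comes back only through a sign change of the product alone.  The last
    coefficient of the product has the sign of [T], or vanishes while credit is
    left, which makes the inequality strict. *)
Lemma sign_changes_mul_linear c T e x l : 0 < c -> T != 0 ->
  (x != 0 -> 0 < T * x) -> (x = 0 -> 0 < T * e) -> e != 0 ->
  (sign_changes T l < sign_changes e (mul_linear c x l) + (0 < T * e)%R)%N.
Proof.
move=> c0; elim: l T e x => [|a l IH] T e x T0 hx0 hx e0 /=.
  case: eqVneq => [/hx ->|x0] //.
  move: (hx0 x0); rewrite !mulr_gt0_gt0 // mulr_lt0_gt0 //.
  by case: (0 < T); case: (0 < e); case: (0 < x).
case: (eqVneq a 0) => [->|a0].
  rewrite mulr0 subr0; case: (eqVneq x 0) => [x0|x0].
    by apply: IH => //; rewrite ?eqxx // => _; exact: hx.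
  have := IH T x 0 T0; rewrite eqxx => /(_ (fun h => ltac:(by [])) (fun _ => hx0 x0) x0).
  rewrite hx0 //; move: (hx0 x0).
  rewrite !mulr_gt0_gt0 // mulr_lt0_gt0 //.
  by case: (0 < T); case: (0 < e); case: (0 < x) => //= _; lia.
have aa : 0 < a * a by rewrite mulr_gt0_gt0 // eqxx.
have hb : x != 0 -> (0 < x) != (0 < a) -> (0 < x - c * a) = (0 < x).
  move=> x0 h; rewrite subr_gt0; apply/idP/idP => [|xp].
    move: h; case: (ltgtP x 0) x0 => // x0 _.
    rewrite eq_sym eqbF_neg negbK => ha /(lt_trans (mulr_gt0 c0 ha)) x1.
    by rewrite (lt_gtF x1) in x0.
  apply: (lt_trans _ xp); rewrite pmulr_rlt0 // ltNge le_eqVlt eq_sym (negbTE a0) /=.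
  by move: h; rewrite xp; case: (_ < a).
case: (eqVneq (x - c * a) 0) => [b0|b0].
  have xE : x = c * a by apply/eqP; rewrite -subr_eq0 b0.
  have x0 : x != 0 by rewrite xE mulf_neq0 // gt_eqF.
  have ax : (0 < x) = (0 < a) by rewrite xE pmulr_rgt0.
  have := IH a e a a0 (fun _ => aa) (fun h => ltac:(by rewrite h eqxx in a0)) e0.
  move: (hx0 x0); rewrite !mulr_gt0_gt0 // mulr_lt0_gt0 // ax.
  by case: (0 < T); case: (0 < e); case: (0 < a) => //= _; lia.
have := IH a _ a a0 (fun _ => aa) (fun h => ltac:(by rewrite h eqxx in a0)) b0.
case: (eqVneq x 0) => [x0|x0].
  have : (0 < x - c * a) = ~~ (0 < a).
    rewrite x0 sub0r oppr_gt0 pmulr_rlt0 //.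
    by case: (ltgtP a 0) a0.
  move: (hx x0); rewrite !mulr_gt0_gt0 // !mulr_lt0_gt0 // => + ->.
  move: (sign_changes a l) (sign_changes (x - c * a) _) => u v.
  by clear; case: (0 < T); case: (0 < e); case: (0 < a) => //= _; lia.
move: (hx0 x0) (hb x0); rewrite !mulr_gt0_gt0 // !mulr_lt0_gt0 //.
move: (sign_changes a l) (sign_changes (x - c * a) _) => u v.
move: (0 < x - c * a) => b; clear.
case: (0 < T); case: (0 < e); case: (0 < a); case: (0 < x) => //= _ h;
 try (rewrite h //; lia); case: b {h} => /=; lia.
Qed.

Lemma coefs_mul_linear c p : p != 0 ->
  polyseq (('X - c%:P) * p) = mul_linear c 0 p.
Proof.
move=> p0.
have sz x l : size (mul_linear c x l) = (size l).+1.
  by elim: l x => //= a l IH x; rewrite IH.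
have nthE x l i : (mul_linear c x l)`_i = (x :: l)`_i - c * l`_i.
  elim: l x i => [|a l IH] x [|i] //=; rewrite ?mulr0 ?subr0 ?nth_nil ?mulr0 ?subr0 //.
apply: (@eq_from_nth _ 0).
  by rewrite sz size_mul ?polyXsubC_eq0 // size_XsubC.
move=> i _; rewrite nthE mulrBl coefB coefXM coefCM.
by case: i.
Qed.

Lemma sign_changes_mulXsubC c p : 0 < c -> p != 0 ->
  (sign_changes 0 p < sign_changes 0 (('X - c%:P) * p)%R)%N.
Proof.
move=> c0 p0; rewrite coefs_mul_linear //.
have : last 0 (polyseq p) != 0 by rewrite -nth_last -lead_coefE lead_coef_eq0.
elim: (polyseq p) => [|b s IH] /=; first by rewrite eqxx.
(* Leading zeros are shifted along; the first nonzero [b] yields [- c * b],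
   of opposite sign, so no credit is available at the start. *)
case: (eqVneq b 0) => [->|b0]; first by rewrite mulr0 subr0 eqxx.
have cb0 : 0 - c * b != 0 by rewrite sub0r oppr_eq0 mulf_neq0 // gt_eqF.
move=> _; rewrite (negbTE cb0) !mul0r ltxx !add0n.
have bb : 0 < b * b by rewrite mulr_gt0_gt0 // eqxx.
have h : (0 < b * (0 - c * b)) = false.
  by rewrite sub0r mulrN mulrCA oppr_gt0 pmulr_rlt0 // (lt_gtF bb).
have := @sign_changes_mul_linear c b (0 - c * b) b s c0 b0 (fun _ => bb).
rewrite h addn0; apply => // b1; by rewrite b1 eqxx in b0.
Qed.

Lemma descartes_pos (rs : seq R) :
  (count (> 0)%R rs <= sign_changes 0 (\prod_(r <- rs) ('X - r%:P))%R)%N.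
Proof.
(* Only the positive roots are peeled off; the other factors stay in [p]. *)
rewrite (bigID (> 0)) /= -big_filter -size_filter.
set p := (X in _ * X).
have prodX0 t (P : pred R) : \prod_(r <- t | P r) ('X - r%:P) != 0.
  by rewrite prodf_seq_neq0; apply/allP => r _; rewrite polyXsubC_eq0 implybT.
have : all (> 0) [seq r <- rs | 0 < r] by exact: filter_all.
elim: [seq r <- rs | 0 < r] => [|r s IH] //= /andP[r0 hs].
rewrite big_cons -mulrA; apply: (leq_ltn_trans (IH hs)).
apply: sign_changes_mulXsubC => //; apply: mulf_neq0; exact: prodX0.
Qed.

Lemma descartes_neg (rs : seq R) :
  (count (< 0)%R rs <= sign_changes 0 (alternate (\prod_(r <- rs) ('X - r%:P))%R))%N.
Proof.
have := descartes_pos (map -%R rs).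
rewrite count_map (eq_count (a2 := (< 0)%R)); last by move=> r /=; rewrite oppr_gt0.
rewrite big_map => /leq_trans; apply.
(* [p] and [p' (- X)] agree up to the sign [(-1) ^+ size rs]. *)
set p := (X in sign_changes 0 (polyseq X)); set p' := (X in alternate (polyseq X)).
have pE i : p`_i = (-1) ^+ (size rs) * (alternate p')`_i.
  rewrite nth_alternate /p /p'; elim: rs i {p p'} => [|r rs IH] i /=.
    by rewrite !big_nil coef1 expr0 mul1r; case: i => [|i]; rewrite ?mulr0 ?mulr1.
  rewrite !big_cons !mulrBl !coefB !coefXM !coefCM !IH.
  by case: i => [|i] /=; rewrite ?exprS; ring.
have sz : size p = size (alternate p').
  by rewrite size_alternate /p /p' !size_prod_XsubC.
have [ho|ho] := boolP (odd (size rs)).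
  rewrite -[0 in X in (_ <= X)%N]oppr0 -sign_changesN.
  rewrite (sign_changes_sg (s' := map -%R (alternate p')) (a' := 0)) ?size_map // => i.
  have [hi|hi] := ltnP i (size (alternate p')).
    by rewrite (nth_map 0) // pE -signr_odd ho mulN1r.
  by rewrite !nth_default ?size_map // sz.
rewrite (sign_changes_sg (s' := alternate p') (a' := 0)) // => i.
by rewrite pE -signr_odd (negbTE ho) mul1r.
Qed.

Lemma prod_XsubC_coef0 (rs : seq R) i : (i < count_mem 0%R rs)%N ->
  (\prod_(r <- rs) ('X - r%:P))`_i = 0.
Proof.
move=> hi; rewrite (bigID (pred1 0)) /=.
rewrite (eq_bigr (fun=> 'X)); last by move=> r /eqP ->; rewrite subr0.
rewrite big_const_seq iter_mulr_1 mulrC coefMXn hi //.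
Qed.

Lemma count_signs (rs : seq R) :
  (count (< 0)%R rs + count (> 0)%R rs + count_mem 0%R rs = size rs)%N.
Proof.
elim: rs => //= r rs <-; rewrite -!addnA.
by case: (ltgtP r 0) => _ /=; lia.
Qed.

End SignChanges.

(** * Pencils of real-rooted polynomials with one moving coefficient *)

Lemma poly_eq_fun (R : realFieldType) (p r : {poly R}) :
  (forall x, p.[x] = r.[x]) -> p = r.
Proof.
move=> h; apply/eqP; rewrite -subr_eq0; apply/eqP.
apply: (@roots_geq_poly_eq0 _ _ [seq i%:R | i <- iota 0 (size (p - r))]).
- by apply/allP => x _; rewrite /root hornerD hornerN h subrr.
- by rewrite map_inj_uniq ?iota_uniq // => i j /eqP; rewrite eqr_nat => /eqP.
- by rewrite size_map size_iota.
Qed.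

Lemma poly_of_signed_values (R : realFieldType) (s : R) (P A B : {poly R}) :
  s * s = 1 -> (forall x, s * P.[x] = A.[x] + B.[x]) -> P = s *: A + s *: B.
Proof.
move=> ss h; apply: poly_eq_fun => x; rewrite hornerD !hornerZ -mulrDr -h.
by rewrite mulrA ss mul1r.
Qed.

(** The number [k] bounds the negative roots and [d - 1 - k] the positive ones,
    uniformly in [t]; since at least one root is [0], a common [k] exists as
    soon as the two counts move little enough.  The hypothesis [1 < q] is what
    makes the case of a moving first coefficient work. *)
Lemma pencil_index (R : realFieldType) (G : {poly R}) (q d : nat) (lo hi : R) :
  (1 < q < d)%N -> size G = d.+1 -> G`_0 = 0 -> lo <= hi ->
  (forall t, lo <= t <= hi -> exists rs : seq R,
     G + t *: 'X^q = \prod_(r <- rs) ('X - r%:P)) ->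
  exists2 k : nat, (k < d)%N & forall (t : R) (rs : seq R), lo <= t <= hi ->
    G + t *: 'X^q = \prod_(r <- rs) ('X - r%:P) ->
    (count (< 0)%R rs <= k)%N /\ (k + count (> 0)%R rs < d)%N.
Proof.
move=> /andP[q1 qd] szG G0 lohi roots_ex.
pose p t := G + t *: 'X^q; pose V t := sign_changes 0 (p t).
pose W t := sign_changes 0 (alternate (p t)).
have szp t : size (p t) = d.+1.
  rewrite /p size_polyDl ?szG //; apply: leq_ltn_trans (size_scale_leq _ _) _.
  by rewrite size_polyXn.
have pE t i : (p t)`_i = G`_i + (if i == q then t else 0).
  by rewrite /p coefD coefZ coefXn; case: eqP => _; rewrite ?mulr1 ?mulr0.
have pq t t' i : i != q -> (p t)`_i = (p t')`_i by rewrite !pE => /negbTE ->.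
have lastp t : last 0 (p t) != 0.
  rewrite -nth_last -lead_coefE lead_coef_eq0 -size_poly_eq0 szp //.
have bound t m : (forall i, (i < m)%N -> (p t)`_i = 0) -> (V t + W t + m <= d)%N.
  by move=> /sign_changes_bound /(_ (lastp t)); rewrite szp.
have bound1 t : (V t + W t < d)%N.
  rewrite -addn1; apply: bound => -[|i] //= _; rewrite pE G0 add0r.
  by case: eqP q1 => // <-.
have suffVW : (exists2 k : nat, (k < d)%N & forall t, lo <= t <= hi ->
    (W t <= k)%N /\ (k + V t < d)%N) ->
  exists2 k : nat, (k < d)%N & forall (t : R) (rs : seq R), lo <= t <= hi ->
    G + t *: 'X^q = \prod_(r <- rs) ('X - r%:P) ->
    (count (< 0)%R rs <= k)%N /\ (k + count (> 0)%R rs < d)%N.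
  case=> k kd h; exists k => // t rs /h[h1 h2] e; split.
    by apply: leq_trans h1; rewrite /W /p e; exact: descartes_neg.
  apply: leq_ltn_trans h2; rewrite leq_add2l /V /p e; exact: descartes_pos.
apply: suffVW.
have sz t t' : size (p t) = size (p t') by rewrite !szp.
have sza t t' : size (alternate (p t)) = size (alternate (p t')).
  by rewrite !size_alternate !szp.
have paq t t' i : i != q -> (alternate (p t))`_i = (alternate (p t'))`_i.
  by move=> iq; rewrite !nth_alternate (pq t t').
(* The parameter at which the moving coefficient vanishes. *)
pose ts := - G`_q.
have pts : (p ts)`_q = 0 by rewrite pE eqxx subrr.
have pats : (alternate (p ts))`_q = 0 by rewrite nth_alternate pts mulr0.
have [Tts|Tts] := boolP (lo <= ts <= hi); last first.
  (* The moving coefficient has a constant sign on the interval. *)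
  exists (W lo) => [|t tT]; first by have := bound1 lo; lia.
  have sgE : Num.sg (p t)`_q = Num.sg (p lo)`_q.
    rewrite !pE eqxx /ts in Tts *; case/andP: tT => t1 t2.
    case/nandP: Tts; rewrite -ltNge => h.
      by rewrite !gtr0_sg //; lra.
    by rewrite !ltr0_sg //; lra.
  have sgpE i : Num.sg (p t)`_i = Num.sg (p lo)`_i.
    by have [->|iq] := eqVneq i q; rewrite // (pq t lo).
  have -> : W t = W lo.
    by apply: sign_changes_sg => // i; rewrite !nth_alternate !sgrM sgpE.
  have -> : V t = V lo by apply: sign_changes_sg.
  by split => //; rewrite addnC.
have [/existsP[i Gi]|] := boolP [exists i : 'I_q, G`_i != 0]; last first.
  (* The moving coefficient is the lowest one.  The bound at [ts] has [q.+1] to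
     spare, against one extra change in each of the two sequences. *)
  rewrite negb_exists => /forallP h0.
  have pts0 i : (i <= q)%N -> (p ts)`_i = 0.
    rewrite leq_eqVlt => /orP[/eqP->//|iq].
    have := h0 (Ordinal iq); rewrite negbK pE (ltn_eqF iq) addr0 => /eqP.
    by [].
  have bt : (V ts + W ts + q.+1 <= d)%N by apply: bound.
  exists (W ts).+1 => [|t _]; first by move: bt; lia.
  have hW : (W t <= (W ts).+1)%N.
    apply: (sign_changes_first (q := q)) => // [i iq|i iq].
      by rewrite nth_alternate pts0 ?mulr0.
    exact: paq.
  have hV : (V t <= (V ts).+1)%N.
    by apply: (sign_changes_first (q := q)) => // i iq; exact: pq.
  by split => //; move: hV bt; lia.
(* The order at the origin is now at most [i] for every parameter.  At [ts] the
   number of nonzero roots is squeezed between the sign changes and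
   their bound, so it equals [V ts + W ts]. *)
have [rs rsE] := roots_ex _ Tts.
have m_le : (count_mem 0%R rs <= i)%N.
  rewrite leqNgt; apply/negP => /prod_XsubC_coef0.
  rewrite -rsE -/(p ts) pE (ltn_eqF (ltn_ord i)) addr0 => e.
  by rewrite e eqxx in Gi.
have attained : (d <= V ts + W ts + count_mem 0%R rs)%N.
  have -> : d = size rs by have := szp ts; rewrite /p rsE size_prod_XsubC => -[].
  have := descartes_pos rs; have := descartes_neg rs.
  rewrite -rsE -/(p ts) -/(V ts) -/(W ts) -count_signs; lia.
exists (W ts) => [|t _]; first by have := bound1 ts; lia.
have hV : (V ts <= V t)%N.
  by apply: (@sign_changes_insert _ 0 _ _ q) => // j jq; exact: pq.
have hW : (W ts <= W t)%N.
  by apply: (@sign_changes_insert _ 0 _ _ q) => // j jq; exact: paq.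
have : (V t + W t + count_mem 0%R rs <= d)%N.
  apply: bound => j hj; have jq : (j < q)%N by have := ltn_ord i; lia.
  by rewrite (pq t ts) ?ltn_eqF // /p rsE prod_XsubC_coef0.
have := bound1 ts; lia.
Qed.
(** The pencil that arises for [q = 1].  Its moving coefficient
    [3 * l0 ^+ 2 - 6 + t] is negative when [l0 = 0], so there is exactly one root
    on each side; when [l0] is [2] or [-2] it is nonnegative, and [0] is the
    largest or the smallest root. *)
Lemma pencil_index1 (R : realFieldType) (G : {poly R}) (l0 : R) :
  G = 'X^3 + (3 * l0) *: 'X^2 + (3 * l0 ^+ 2 - 6) *: 'X ->
  l0 ^+ 3 - 4 * l0 = 0 ->
  exists2 k : nat, (k < 3)%N & forall (t : R) (rs : seq R), - 6 <= t <= 3 ->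
    G + t *: 'X^1 = \prod_(r <- rs) ('X - r%:P) ->
    (count (< 0)%R rs <= k)%N /\ (k + count (> 0)%R rs < 3)%N.
Proof.
move=> GE hl.
pose c t : seq R := [:: 0; 3 * l0 ^+ 2 - 6 + t; 3 * l0; 1].
have pE t : polyseq (G + t *: 'X^1) = c t.
  have -> : G + t *: 'X^1 = Poly (c t).
    apply/polyP => i; rewrite coef_Poly GE !(coefD, coefZ, coefXn, coefX).
    by case: i => [|[|[|[|[|i]]]]] /=; ring.
  by rewrite (@PolyK _ 0) //= oner_neq0.
have bnd t : (sign_changes 0%R (c t) + sign_changes 0%R (alternate (c t)) < 3)%N.
  have := @sign_changes_bound R 1 (c t); rewrite addn1 /=; apply; rewrite ?oner_neq0 //.
  by case.
have key : exists2 k : nat, (k < 3)%N & forall t, - 6 <= t <= 3 ->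
    (sign_changes 0%R (alternate (c t)) <= k)%N /\ (k + sign_changes 0%R (c t) < 3)%N.
  have : l0 * ((l0 - 2) * (l0 + 2)) = 0 by rewrite -hl; ring.
  move/eqP; rewrite !mulf_eq0 subr_eq0 addr_eq0 => /or3P[] /eqP hl0.
  - exists 1%N => // t /andP[t1 t2]; rewrite /c hl0.
    move: (_ + t) (ltac:(lra) : 3 * 0 ^+ 2 - 6 + t < 0) => a a0.
    rewrite /= !(mulr0, opprK, oppr0) !eqxx !oppr_eq0 (lt_eqF a0) !oner_eq0 !mul0r !ltxx /=.
    by rewrite mulrNN !mulr1 a0.
  - have V0 t : - 6 <= t <= 3 -> sign_changes 0%R (c t) = 0%N.
      move=> /andP[t1 _]; rewrite /c hl0.
      move: (_ + t) (ltac:(lra) : 0 <= 3 * 2 ^+ 2 - 6 + t) => a a0.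
      have b0 : (0 : R) < 3 * 2 by lra.
      move: (3 * 2) b0 => b b0.
      rewrite /= eqxx (gt_eqF b0) oner_eq0 !mul0r ltxx mulr1 (lt_gtF b0).
      case: ifP => // _; rewrite ltNge mulr_ge0 // ltW //.
    by exists 2%N => // t tT; rewrite V0 // addn0; have := bnd t; rewrite V0.
  - have W0 t : - 6 <= t <= 3 -> sign_changes 0%R (alternate (c t)) = 0%N.
      move=> /andP[t1 _]; rewrite /c hl0.
      move: (_ + t) (ltac:(lra) : 0 <= 3 * (- 2) ^+ 2 - 6 + t) => a a0.
      have b0 : (3 * - 2 : R) < 0 by lra.
      move: (3 * - 2) b0 => b b0.
      rewrite /= eqxx !oppr_eq0 (lt_eqF b0) oner_eq0 !mul0r ltxx !opprK mulrN1 oppr_lt0 (lt_gtF b0).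
      case: ifP => // _; rewrite ltNge mulNr oppr_ge0 mulr_ge0_le0 // ltW //.
    by exists 0%N => // t tT; rewrite W0 //; have := bnd t; rewrite W0 // addn0.
case: key => k k3 h; exists k => // t rs /h [h1 h2] e.
have := descartes_pos rs; have := descartes_neg rs; rewrite -e pE => e1 e2.
split; first exact: leq_trans h1.
by apply: leq_ltn_trans h2; rewrite leq_add2l.
Qed.

Lemma cubic_shift (R : realFieldType) (P : {poly R}) (c : R) :
  (forall x, P.[x] = - x ^+ 3 + 6 * x - 2 * c) -> c ^+ 3 = 4 * c ->
  ((-1) *: P) \Po ('X + c%:P) = 'X^3 + (3 * c) *: 'X^2 + (3 * c ^+ 2 - 6) *: 'X.
Proof.
move=> PE c3; apply: poly_eq_fun => y.
rewrite horner_comp !(hornerD, hornerZ, hornerXn, hornerX, hornerC) PE.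
have -> : (y + c) ^+ 3 = y ^+ 3 + 3 * c * y ^+ 2 + 3 * c ^+ 2 * y + c ^+ 3 by ring.
by rewrite c3; ring.
Qed.

(** * Ordered eigenvalues of Hermitian matrices *)

Lemma nth_sort_eq (R : realFieldType) (s : seq R) (c : R) k :
  (count (< c)%R s <= k)%N -> (k + count (> c)%R s < size s)%N ->
  (sort <=%R s)`_k = c.
Proof.
have /permP cnt : perm_eq (sort <=%R s) s by rewrite perm_sort.
rewrite -!cnt -(size_sort <=%R s); set s' := sort _ s.
have srt : sorted <=%R s' by apply: sort_sorted; exact: le_total.
move=> h1 h2; have ks : (k < size s')%N by exact: leq_ltn_trans (leq_addr _ _) h2.
have mono i j : (i <= j)%N -> (j < size s')%N -> s'`_i <= s'`_j.
  move=> ij js; apply: (le_sorted_leq_nth 0 srt) => //; rewrite inE //.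
  exact: leq_ltn_trans js.
apply/eqP; rewrite eq_le !leNgt; apply/andP; split; apply/negP => hk.
- have : (size (drop k s') <= count (> c)%R s')%N.
    rewrite -[s' in X in (_ <= X)%N](cat_take_drop k) count_cat.
    have /eqP -> : count (> c) (drop k s') == size (drop k s').
      rewrite -all_count; apply/(all_nthP 0) => i; rewrite size_drop => hi.
      rewrite nth_drop /=.
      by apply: lt_le_trans hk _; apply: mono; rewrite ?leq_addr -?ltn_subRL.
    exact: leq_addl.
  by rewrite size_drop leq_subLR leqNgt h2.
- have : (size (take k.+1 s') <= count (< c)%R s')%N.
    rewrite -[s' in X in (_ <= X)%N](cat_take_drop k.+1) count_cat.
    have /eqP -> : count (< c) (take k.+1 s') == size (take k.+1 s').
      rewrite -all_count; apply/(all_nthP 0) => i; rewrite size_takel // => hi.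
      rewrite nth_take //=.
      by apply: le_lt_trans hk; apply: mono.
    exact: leq_addr.
  by rewrite size_takel // ltnNge h1.
Qed.

Lemma hermitian_root_real (R : realType) n (A : 'M[R[i]]_n) (z : R[i]) :
  A ^t* = A -> root (char_poly A) z -> z = (complex.Re z)%:C.
Proof.
move=> hA; rewrite -eigenvalue_root_char => /eigenvalueP[v vA v0].
apply/esym/RRe_real/CrealP.
pose w := v *m v ^t*.
have w0 : w 0 0 != 0.
  rewrite mxE psumr_neq0 => [|j _]; last by rewrite !mxE mul_conjC_ge0.
  have [j vj] : exists j, v 0 j != 0.
    apply/existsP; apply: contraNT v0; rewrite negb_exists => /forallP h.
    by apply/eqP/rowP => j; rewrite mxE; apply/eqP; rewrite -[_ == _]negbK.
  by apply/hasP; exists j; rewrite ?mem_index_enum // !mxE /= mul_conjC_gt0.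
apply: (mulIf w0).
have e1 : v *m A *m v ^t* = z *: w by rewrite vA -scalemxAl.
have e2 : (v *m A *m v ^t*) ^t* = v *m A *m v ^t*.
  by rewrite !trmx_mul !map_mxM map_trmx -map_mx_comp (map_mx_id (@conjCK _)) trmxK hA mulmxA.
have e3 : w ^t* = w.
  by rewrite /w !trmx_mul !map_mxM map_trmx -map_mx_comp (map_mx_id (@conjCK _)) trmxK.
have := e2; rewrite e1 linearZ /= map_mxZ e3 => /matrixP/(_ 0 0).
by rewrite !mxE.
Qed.

Lemma det_subr_scalar (R : comNzRingType) n (A : 'M[R]_n) x :
  \det (A - x%:M) = (-1) ^+ n * (char_poly A).[x].
Proof.
rewrite -(opprB x%:M) -scaleN1r detZ; congr (_ * _).
rewrite /char_poly -horner_evalE -det_map_mx; congr (\det _).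
apply/matrixP => i j; rewrite !mxE /= horner_evalE hornerD hornerN hornerC.
by rewrite hornerMn hornerX.
Qed.

Lemma kagome_hermitian (R : realType) p q (t1 t2 w : R) :
  (kagome_mx p q t1 t2 w) ^t* = kagome_mx p q t1 t2 w.
Proof.
have K (m n : nat) (B : 'M[R[i]]_(m, n)) : B ^t* ^t* = B.
  by rewrite map_trmx trmxK -map_mx_comp (map_mx_id (@conjCK _)).
rewrite /kagome_mx; move: (kagomeA _ _ _ _ _) (kagomeB _ _ _ _ _) (kagomeC _ _ _ _ _).
move=> A B C.
rewrite !(tr_block_mx, tr_row_mx, tr_col_mx) !(map_block_mx, map_row_mx, map_col_mx).
by rewrite 3!K !trmx0 !map_mx0.
Qed.

Lemma char_poly_hermitian (R : realType) n (A : 'M[R[i]]_n) : A ^t* = A ->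
  char_poly A =
    map_poly (real_complex R) (\prod_(r <- ordered_eigenvalues A) ('X - r%:P)).
Proof.
move=> hA; rewrite /ordered_eigenvalues.
case: closed_field_poly_normal => s /= sE.
rewrite (perm_big _ (permEl (perm_sort _ _))) /= big_map rmorph_prod /=.
rewrite sE (monicP (char_poly_monic A)) scale1r.
rewrite big_seq [RHS]big_seq; apply: eq_bigr => z zs.
rewrite rmorphB /= map_polyX map_polyC /=; congr (_ - _%:P).
apply: (hermitian_root_real hA); rewrite sE rootZ ?lead_coef_eq0 ?monic_neq0 ?char_poly_monic //.
by rewrite root_prod_XsubC.
Qed.

Lemma size_ordered_eigenvalues (R : realType) n (A : 'M[R[i]]_n) : A ^t* = A ->
  size (ordered_eigenvalues A) = n.
Proof.
move=> hA; have := size_char_poly A; rewrite (char_poly_hermitian hA).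
by rewrite size_map_poly size_prod_XsubC => -[].
Qed.

(** * The range of the trigonometric factor *)

(** The lower bound is [`|1 + expi x + expi y| ^+ 2 >= 0], the left-hand side
    being [3 + 2 * ptriangle x y]. *)
Lemma ptriangle_bounds (R : realType) (x y : R) : - (3 / 2) <= ptriangle x y <= 3.
Proof.
apply/andP; split; last first.
  by have := cos_le1 x; have := cos_le1 y; have := cos_le1 (x - y); rewrite /ptriangle; lra.
rewrite /ptriangle cosB.
have := sqr_ge0 (1 + cos x + cos y); have := sqr_ge0 (sin x + sin y).
have := cos2Dsin2 x; have := cos2Dsin2 y; nra.
Qed.

(** On the line [y = - x] the function is [2 * c ^+ 2 + 2 * c - 1] in
    [c = cos x], and [c = (sqrt (3 + 2 t) - 1) / 2] solves for [t]. *)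
Lemma ptriangle_surj (R : realType) (t : R) : - (3 / 2) <= t <= 3 ->
  exists x y : R, ptriangle x y = t.
Proof.
move=> /andP[t1 t2].
have d0 : 0 <= 3 + 2 * t by lra.
pose d := Num.sqrt (3 + 2 * t).
have dE : d ^+ 2 = 3 + 2 * t by rewrite sqr_sqrtr.
have dge : 0 <= d by exact: sqrtr_ge0.
pose c := (d - 1) / 2.
have cI : c \in `[(-1), 1] by rewrite in_itv /= /c; nra.
exists (acos c), (- acos c).
rewrite /ptriangle cosN opprK cosD (acosK cI) -!expr2.
have := cos2Dsin2 (acos c); rewrite (acosK cI) => h.
have -> : sin (acos c) ^+ 2 = 1 - c ^+ 2 by rewrite -h; ring.
rewrite /c; nra.
Qed.

(** * The kagome matrix when q = 1 *)

Section Expi.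
Variable R : realType.
Implicit Types s t : R.

Lemma expiD s t : expi (s + t) = expi s * expi t.
Proof. by apply/eqP; rewrite eq_complex /= cosD sinD eqxx addrC eqxx. Qed.

Lemma expi0 : expi (0 : R) = 1.
Proof. by rewrite /expi cos0 sin0. Qed.

Lemma expi_conj s : Num.conj (expi s) = expi (- s).
Proof. by rewrite /expi cosN sinN. Qed.

Lemma expiNpi : expi (- pi : R) = -1.
Proof.
by apply/eqP; rewrite eq_complex /= cosN sinN cospi sinpi oppr0 !eqxx.
Qed.

Lemma expi_mulN s : expi s * expi (- s) = 1.
Proof. by rewrite -expiD subrr expi0. Qed.

End Expi.

Lemma cos_pi_int (R : realType) (p : int) : cos (pi + 2 * (p%:~R * pi) : R) = -1.
Proof.
have h n (x : R) : cos (x + 2 * (n%:R * pi)) = cos x.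
  by rewrite -(periodicn (@cosD2pi R) n x); congr (cos (_ + _)); ring.
case: p => n; first by rewrite -pmulrn h cospi.
rewrite NegzE mulrNz -cosN -pmulrn opprD mulNr mulrN opprK h cosN cospi //.
Qed.

Lemma det_mx111 (R : comNzRingType) (N : 'M[R]_(1 + (1 + 1))) :
  let i0 := lshift (1 + 1) 0 in let i1 := rshift 1 (lshift 1 0) in
  let i2 := rshift 1 (rshift 1 0) in
  \det N = N i0 i0 * (N i1 i1 * N i2 i2 - N i1 i2 * N i2 i1)
        - N i0 i1 * (N i1 i0 * N i2 i2 - N i1 i2 * N i2 i0)
        + N i0 i2 * (N i1 i0 * N i2 i1 - N i1 i1 * N i2 i0).
Proof.
move=> i0 i1 i2.
have [F NE] : exists F : nat -> nat -> R, forall i j : 'I_(1 + (1 + 1)), N i j = F i j.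
  by exists (fun i j => N (inord i) (inord j)) => i j; rewrite !inord_val.
rewrite (expand_det_row _ ord0) !big_ord_recl big_ord0 /cofactor.
rewrite !(expand_det_row _ ord0) !big_ord_recl !big_ord0 /cofactor !det_mx11 !mxE.
rewrite !NE /= /bump /=; ring.
Qed.

(** At these parameters the two summands cancel in the blocks [A] and [C], while
    the block [B] has modulus [2]; the determinant at a single point determines
    [Q]. *)
Lemma det_kagome1 (R : realType) (p : int) (w : R) (l : R[i]) :
  let t := pi + p%:~R * pi in
  \det (kagome_mx p 1 t t w - l%:M) = - l ^+ 3 + 4 * l.
Proof.
move=> t.
have g1 : - gammapq R p 1 / 2 = - (p%:~R * pi) by rewrite /gammapq; field.
have tN : expi (- t) = - expi (- (p%:~R * pi)).
  by rewrite /t opprD expiD expiNpi mulN1r.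
have J1 : Jmx R p 1 = 1.
  apply/matrixP => i j; rewrite !ord1 !mxE /= mul0r expi0 //.
have K1 : Kmx R 1 = 1 by apply/matrixP => i j; rewrite !ord1 !mxE /=.
have I1 : (1 : 'M[R[i]]_1) ^t* = 1 by rewrite trmx1 map_mx1.
have A0 : kagomeA p 1 t t w = 0.
  rewrite /kagomeA J1 K1 I1 mulmx1 -scalerDl subrr oppr0 expi0 mulr1 g1 tN.
  by rewrite addNr scale0r scaler0.
have C0 : kagomeC p 1 t t w = 0.
  rewrite /kagomeC J1 K1 I1 mulmx1 -scalerDl subrr expi0 mulr1 g1 tN.
  by rewrite subrr scale0r scaler0.
pose b := expi (- (w + gammapq R p 1 / 8)) * (2 * expi (- t)).
have BE : kagomeB p 1 t t w = b%:M.
  rewrite /kagomeB J1 K1 I1 -scalerDl scalerA /b.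
  apply/matrixP => i j; rewrite !ord1 !mxE eqxx mulr1 mulr1n; ring.
have bb : b * Num.conj b = 4.
  have conjM (x y : R[i]) : Num.conj (x * y) = Num.conj x * Num.conj y.
    exact: rmorphM.
  have conj2 : Num.conj (2 : R[i]) = 2 by exact: rmorph_nat.
  rewrite /b !conjM !expi_conj conj2 !opprK.
  have e1 := expi_mulN (w + gammapq R p 1 / 8); have e2 := expi_mulN t.
  move: e1 e2; set u := expi (_ + _); set u' := expi (- (_ + _)) => e1 e2.
  transitivity (u * u' * (expi t * expi (- t)) * 4); first by ring.
  by rewrite e1 e2; ring.
rewrite /kagome_mx A0 C0 BE trmx0 map_mx0.
rewrite !(scalar_mx_block, opp_block_mx, add_block_mx) !oppr0 !addr0 !sub0r det_mx111.
rewrite !(block_mxEul, block_mxEur, block_mxEdl, block_mxEdr,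
  row_mxEl, row_mxEr, col_mxEu, col_mxEd).
rewrite !mxE eqxx !mulr1n -bb; ring.
Qed.

(** [q] is the size of the blocks, so a context where [q = 1] is only a
    hypothesis needs this form. *)
Lemma det_kagome_q1 (R : realType) (p : int) (q : nat) (w : R) (l : R[i]) :
  q = 1%N -> let t := pi + p%:~R * pi in
  \det (kagome_mx p q t t w - l%:M) = - l ^+ 3 + 4 * l.
Proof. by move->; exact: det_kagome1. Qed.

(** * Flat bands *)

Section FlatBands.
Variables (R : realType) (p : int) (q : nat) (hq : (0 < q)%N) (omega : R).
Variable Q : {poly R[i]}.
Let pt (theta1 theta2 : R) : R :=
  ptriangle (q%:R * (theta1 + p%:~R * pi)) (q%:R * (theta2 + p%:~R * pi)).
Let l0 : R := - 2 * cos (3 * omega - gammapq R p q / 8).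
Hypothesis hQ : forall (theta1 theta2 : R) (lambda : R[i]),
  \det (kagome_mx p q theta1 theta2 omega - lambda%:M) =
  Q.[lambda] + 2 * (pt theta1 theta2)%:C
    * (lambda + (2 * cos (3 * omega - gammapq R p q / 8))%:C) ^+ q.
Let eigs t1 t2 := ordered_eigenvalues (kagome_mx p q t1 t2 omega).
Let N := (q + (q + q))%N.
Let e : R := (-1) ^+ N.

Lemma size_eigs t1 t2 : size (eigs t1 t2) = N.
Proof. by apply: size_ordered_eigenvalues; exact: kagome_hermitian. Qed.

Lemma det_eigs t1 t2 (l : R) :
  \det (kagome_mx p q t1 t2 omega - (l%:C)%:M) =
  (e * (\prod_(r <- eigs t1 t2) ('X - r%:P)).[l])%:C.
Proof.
rewrite det_subr_scalar (char_poly_hermitian (kagome_hermitian _ _ _ _ _)).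
by rewrite horner_map rmorphM rmorphXn rmorphN1.
Qed.

Lemma eigs_pencil t1 t2 (l : R) :
  (e * (\prod_(r <- eigs t1 t2) ('X - r%:P)).[l])%:C =
  Q.[l%:C] + (2 * pt t1 t2 * (l - l0) ^+ q)%:C.
Proof.
rewrite -det_eigs hQ; congr (_ + _).
rewrite !rmorphM rmorph_nat rmorphXn; congr (_ * _ ^+ q).
by rewrite /l0 mulNr opprK rmorphD rmorphM rmorph_nat.
Qed.

Lemma pt_surj t : - (3 / 2) <= t <= 3 -> exists t1 t2, pt t1 t2 = t.
Proof.
move=> /ptriangle_surj[x [y <-]].
exists (x / q%:R - p%:~R * pi), (y / q%:R - p%:~R * pi); rewrite /pt !subrK.
have q0 : (q%:R : R) != 0 by rewrite pnatr_eq0 -lt0n.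
by rewrite !mulrA ![q%:R * _]mulrC !mulfK.
Qed.

(** A flat band with value [c] makes the determinant at [c] vanish both where
    the trigonometric factor is [0] and where it is [1]. *)
Lemma flat_band_root k : (k < N)%N -> flat_band p q omega k -> Q.[l0%:C] = 0.
Proof.
move=> kN fb; pose c := (eigs 0 0)`_k.
have root0 t1 t2 : Q.[c%:C] + (2 * pt t1 t2 * (c - l0) ^+ q)%:C = 0.
  rewrite -eigs_pencil; suff -> : (\prod_(r <- eigs t1 t2) ('X - r%:P)).[c] = 0.
    by rewrite mulr0.
  apply/rootP; rewrite root_prod_XsubC /c [(eigs 0 0)`_k](fb 0 0 t1 t2).
  by rewrite mem_nth // size_eigs.
have [a1 [a2 ha]] : exists t1 t2, pt t1 t2 = 0 by apply: pt_surj; lra.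
have [b1 [b2 hb]] : exists t1 t2, pt t1 t2 = 1 by apply: pt_surj; lra.
have := root0 a1 a2; rewrite ha mulr0 mul0r addr0 => Qc.
have := root0 b1 b2; rewrite Qc add0r hb mulr1 => /eqP.
rewrite fmorph_eq0 mulf_eq0 pnatr_eq0 /= expf_eq0 hq /= subr_eq0 => /eqP cl.
by rewrite -cl.
Qed.

(** After division by [(-1) ^+ N] and translation by [l0], the characteristic
    polynomials form a pencil [G + t *: 'X^q] to which [pencil_index], or
    [pencil_index1] when [q = 1], applies. *)
Lemma root_flat_band :
  Q.[l0%:C] = 0 -> exists2 k, (k < N)%N & flat_band p q omega k.
Proof.
move=> Ql0.
have dbl (a b : R) : a * a = 1 -> 2 * a * (a * b / 2) = b.
  by move=> h; transitivity (a * a * b); [field|rewrite h mul1r].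
pose P t1 t2 := \prod_(r <- eigs t1 t2) ('X - r%:P).
have [s [sE pencil]] : exists s : R, s = (-1) ^+ N /\ forall t1 t2 l,
    (s * (P t1 t2).[l])%:C = Q.[l%:C] + (2 * pt t1 t2 * (l - l0) ^+ q)%:C.
  by exists e; split => // t1 t2 l; exact: eigs_pencil.
have sgE : s = 1 \/ s = -1.
  by rewrite sE -signr_odd; case: odd; [right|left].
have ss : s * s = 1 by case: sgE => ->; rewrite ?mulrNN mulr1.
(* [Q] takes real values at real points because the eigenvalues are real. *)
have [G0 QG0] : exists G0 : {poly R}, forall l : R, Q.[l%:C] = (G0.[l])%:C.
  exists (s *: P 0 0 - (2 * pt 0 0) *: ('X - l0%:P) ^+ q) => l.
  by rewrite !hornerE rmorphB [X in X - _]pencil addrK.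
have G0l0 : G0.[l0] = 0 by apply: (fmorph_inj (real_complex R)); rewrite rmorph0 -Ql0 QG0.
clear Ql0.
have PE t1 t2 : P t1 t2 = s *: G0 + s *: ((2 * pt t1 t2) *: ('X - l0%:P) ^+ q).
  apply: (poly_of_signed_values ss) => l; apply: (fmorph_inj (real_complex R)).
  by rewrite rmorphD -[X in X + _]QG0 [LHS]pencil !hornerE.
pose G := (s *: G0) \Po ('X + l0%:P).
pose rs t1 t2 := [seq r - l0 | r <- eigs t1 t2].
have shift t1 t2 : G + (2 * s * pt t1 t2) *: 'X^q = \prod_(r <- rs t1 t2) ('X - r%:P).
  rewrite big_map; transitivity (P t1 t2 \Po ('X + l0%:P)).
    rewrite PE scalerA mulrA (mulrC s) /G comp_polyD !comp_polyZ.
    congr (_ + _ *: _); rewrite [RHS](rmorphXn (comp_poly _)) /=.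
    by rewrite comp_polyB comp_polyX comp_polyC addrK.
  rewrite /P [LHS](rmorph_prod (comp_poly _)) /=; apply: eq_bigr => r _.
  by rewrite comp_polyB comp_polyX comp_polyC polyCB opprB addrA.
have G00 : G`_0 = 0.
  by rewrite -horner_coef0 /G horner_comp !hornerE G0l0 mulr0.
have suffK (k : nat) : (k < N)%N ->
    (forall t1 t2, (count (< 0)%R (rs t1 t2) <= k)%N /\
                   (k + count (> 0)%R (rs t1 t2) < N)%N) ->
    exists2 k, (k < N)%N & flat_band p q omega k.
  move=> kN h; exists k; first exact: kN.
  rewrite /flat_band => t1 t2 t1' t2'.
  suff E s1 s2 : band_fun p q omega k s1 s2 = l0 by rewrite !E.
  have srt : sort <=%R (eigs s1 s2) = eigs s1 s2.
    by apply: sorted_sort; [exact: le_trans|apply: sort_sorted; exact: le_total].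
  rewrite /band_fun -/(eigs s1 s2) -srt.
  have := h s1 s2; rewrite /rs !count_map => -[h1 h2].
  apply: nth_sort_eq.
    by apply: leq_trans h1; apply: sub_count => r /=; rewrite subr_lt0.
  rewrite size_eigs; apply: leq_ltn_trans h2; rewrite leq_add2l.
  by apply: sub_count => r /=; rewrite subr_gt0.
have [q1|q1] := ltnP 1 q.
  have qN : (q < N)%N by rewrite /N; lia.
  have szG : size G = N.+1.
    have -> : G = (\prod_(r <- rs 0 0) ('X - r%:P)) + (- (2 * s * pt 0 0)) *: 'X^q.
      by rewrite -shift scaleNr addrK.
    rewrite size_polyDl size_prod_XsubC size_map size_eigs //.
    by apply: leq_ltn_trans (size_scale_leq _ _) _; rewrite size_polyXn.
  (* The pencil parameter is [2 * s * t] for [t] in [[-3/2, 3]]. *)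
  have [lo [hi [lohi rng]]] : exists lo hi : R,
      lo <= hi /\ forall t, (lo <= t <= hi) = (- (3 / 2) <= s * t / 2 <= 3).
    case: sgE => ->; [exists (-3), 6|exists (-6), 3]; split; try lra.
      by move=> t; apply/andP/andP => -[h1 h2]; split; lra.
    by move=> t; apply/andP/andP => -[h1 h2]; split; lra.
  have qqN : (1 < q < N)%N by rewrite q1.
  have [|k kN h] := pencil_index qqN szG G00 lohi.
    move=> t; rewrite rng => /pt_surj[t1 [t2 h]].
    by exists (rs t1 t2); rewrite -shift h dbl.
  apply: (suffK k kN) => t1 t2; apply: (h (2 * s * pt t1 t2)); last by rewrite -shift.
  rewrite rng; have -> : s * (2 * s * pt t1 t2) / 2 = pt t1 t2.
    by transitivity (s * s * pt t1 t2); [field|rewrite ss mul1r].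
  exact: ptriangle_bounds.
have qE : q = 1%N by lia.
(* The parameters of [det_kagome1], where the trigonometric factor is [-1]. *)
pose t0 := pi + p%:~R * pi : R.
have pt0 : pt t0 t0 = -1.
  rewrite /pt qE mul1r /ptriangle subrr cos0.
  have -> : t0 + p%:~R * pi = pi + 2 * (p%:~R * pi) by rewrite /t0; ring.
  by rewrite cos_pi_int; ring.
have G0E l : G0.[l] = - l ^+ 3 + 6 * l - 2 * l0.
  have := det_kagome_q1 p omega l%:C qE; rewrite /= -/t0 det_eigs eigs_pencil pt0 QG0 => h.
  have {}h : G0.[l] + 2 * -1 * (l - l0) ^+ q = - l ^+ 3 + 4 * l.
    apply: (fmorph_inj (real_complex R)).
    by rewrite rmorphD /= h rmorphD rmorphN rmorphXn rmorphM rmorph_nat.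
  by move: h; rewrite qE expr1 => h; lra.
have eN : s = -1 by rewrite sE /N qE -signr_odd.
have GE : G = 'X^3 + (3 * l0) *: 'X^2 + (3 * l0 ^+ 2 - 6) *: 'X.
  have l03 : l0 ^+ 3 = 4 * l0 by move: G0l0; rewrite G0E; lra.
  by rewrite /G eN; exact: cubic_shift G0E l03.
have [|k k3 h] := pencil_index1 GE; first by move: G0l0; rewrite G0E; lra.
have NE : N = 3%N by rewrite /N qE.
apply: (suffK k); rewrite NE // => t1 t2.
apply: (h (2 * s * pt t1 t2)); last by rewrite -shift qE.
have := ptriangle_bounds (q%:R * (t1 + p%:~R * pi)) (q%:R * (t2 + p%:~R * pi)).
by rewrite -/(pt t1 t2) eN; lra.
Qed.
End FlatBands.

Theorem corollary1p3 (R : realType) (p : int) (q : nat) (hq : (0 < q)%N)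
    (hpq : coprimez p q%:Z) (omega : R) (Q : {poly R[i]})
    (hQ : forall (theta1 theta2 : R) (lambda : R[i]),
      \det (kagome_mx p q theta1 theta2 omega - lambda%:M) =
      Q.[lambda]
      + 2 * (ptriangle (q%:R * (theta1 + p%:~R * pi))
                       (q%:R * (theta2 + p%:~R * pi)))%:C
          * (lambda + (2 * cos (3 * omega - gammapq R p q / 8))%:C) ^+ q) :
  (exists k : 'I_(3 * q), flat_band p q omega k) <->
  Q.[(- 2 * cos (3 * omega - gammapq R p q / 8))%:C] = 0.
Proof.
have N3 : (3 * q = q + (q + q))%N by lia.
split=> [[k fb]|Q0].
  by apply: (flat_band_root hq hQ (k := k)) => //; rewrite -N3.
have [k kN fb] := root_flat_band hq hQ Q0.
by rewrite -N3 in kN; exists (Ordinal kN).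
Qed.
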